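(* If $\|\Gamma_\infty A\Gamma_\infty\|_{2\to2}\le 1$, then the normalized vector of magnetizations $\tilde m^{(n)}$ converges to $0$ exponentially fast in $\mu_{J_n}$-probability. By this it is meant more precisely that for each $\varepsilon>0$ there is a constant $I_\varepsilon$ such that $$\mu_{J_n}\big(\|\tilde m^{(n)}\|\ge\varepsilon\big)\le\exp(-N I_\varepsilon),\qquad N=N(n).$$
   Context: Setting (block spin Ising model). Let $k\in\mathbb{N}$ and let $A\in\mathbb{R}^{k\times k}$ be symmetric and positive definite (the block interaction matrix). Let $N=N(n)$ be a strictly increasing sequence in $\mathbb{N}$, and for each $n$ let $B_1^{(n)},\dots,B_k^{(n)}$ be a partition of $\{1,\dots,N\}$ into $k$ blocks, ordered so that $i_0\in B_i^{(n)}$, $j_0\in B_j^{(n)}$, $i<j$ implies $i_0<j_0$. Assume that for each $i$ the limit $\gamma_i=\lim_{n\to\infty}\sqrt{|B_i^{(n)}|/N}\in(0,1)$ exists, and put $\Gamma_\infty=\mathrm{diag}(\gamma_1,\dots,\gamma_k)$. Let $h(a)$ denote the index of the block containing $a\in\{1,\dots,N\}$ and let $J_n\in\mathbb{R}^{N\times N}$ be the matrix with entries $(J_n)_{ab}=\frac1N A_{h(a)h(b)}$. Let $\mu_{J_n}$ be the probability measure on $\{-1,+1\}^N$ given by $\mu_{J_n}(x)=Z_n^{-1}\exp(\frac12\langle x,J_nx\rangle)$, with $Z_n$ the normalizing constant. For $x\in\{-1,+1\}^N$, $\tilde m^{(n)}(x)\in\mathbb{R}^k$ has components $\tilde m^{(n)}_i(x)=\frac{1}{|B_i^{(n)}|}\sum_{j\in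 B_i^{(n)}}x_j$. $\|\cdot\|$ is a norm on $\mathbb{R}^k$, and $\|\cdot\|_{2\to2}$ is the operator norm with respect to the Euclidean norm.
   Formalization: The constant I_ε is required to be positive and the bound is claimed for all sufficiently large n; for every n it fails, e.g. when all blocks are singletons and ε is small the probability is 1. *)

(* Defs.v *)
From mathcomp Require Import all_boot all_order all_algebra.
From mathcomp Require Import all_classical all_reals all_analysis.
Import Order.TTheory GRing.Theory Num.Theory.

Set Implicit Arguments.
Unset Strict Implicit.
Unset Printing Implicit Defensive.

Local Open Scope ring_scope.

Definition positive_definite (R : realType) (k : nat) (A : 'M[R]_k) : Prop :=
  forall v : 'cV[R]_k, v != 0 -> 0 < (v^T *m A *m v) 0 0.

(* [`|v|] on matrices is the max norm, so the Euclidean norm needs its own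
   definition. *)
Definition euclidean_norm (R : realType) (k : nat) (v : 'cV[R]_k) : R :=
  Num.sqrt (\sum_i v i 0 ^+ 2).

(* [sup] is 0 on sets without a supremum; [has_sup_opnorm2] shows that this
   does not occur here. *)
Definition opnorm2 (R : realType) (k : nat) (M : 'M[R]_k) : R :=
  sup [set euclidean_norm (M *m v) | v in
        [set v : 'cV[R]_k | euclidean_norm v <= 1]]%classic.

Lemma has_sup_opnorm2 (R : realType) (k : nat) (M : 'M[R]_k) :
  has_sup [set euclidean_norm (M *m v) | v in
            [set v : 'cV[R]_k | euclidean_norm v <= 1]]%classic.
Proof.
split.
  exists (euclidean_norm (M *m 0)), 0 => //=.
  rewrite /euclidean_norm big1 ?sqrtr0 // => i _.
  by rewrite mxE expr0n.
exists (Num.sqrt (\sum_i (\sum_j `|M i j|) ^+ 2)) => _ [v /= v1 <-].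
apply: ler_wsqrtr; apply: ler_sum => i _.
rewrite -real_normK ?num_real // lerXn2r ?nnegrE ?sumr_ge0 //.
rewrite mxE; apply: (le_trans (ler_norm_sum _ _ _)); apply: ler_sum => j _.
rewrite normrM ler_piMr //; apply: le_trans v1.
rewrite -sqrtr_sqr; apply: ler_wsqrtr.
by rewrite (bigD1 j) //= lerDl sumr_ge0 // => l _; exact: sqr_ge0.
Qed.

Definition is_norm (R : realType) (k : nat) (p : 'cV[R]_k -> R) : Prop :=
  [/\ forall x y, p (x + y) <= p x + p y,
      forall (a : R) x, p (a *: x) = `|a| * p x
    & forall x, p x = 0 -> x = 0].

(* [injective B] excludes listing the same block under two indices, which the
   set of blocks does not record.  The sites 1, ..., N are numbered from 0. *)
Definition ordered_block_partition (k N : nat) (B : 'I_k -> {set 'I_N}) : Prop :=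
  [/\ injective B,
      finset.partition [set B i | i : 'I_k]%SET [set: 'I_N]%SET
    & forall (i j : 'I_k) (a b : 'I_N),
        a \in B i -> b \in B j -> (i < j)%N -> (a < b)%N].

Definition block_interaction (R : realType) (k N : nat) (A : 'M[R]_k)
    (h : 'I_N -> 'I_k) : 'M[R]_N :=
  \matrix_(a < N, b < N) (N%:R^-1 * A (h a) (h b)).

(* A configuration in {-1,+1}^N is coded by a Boolean function, with [true]
   standing for +1 and [false] for -1. *)
Definition config (N : nat) := {ffun 'I_N -> bool}.

Definition spins (R : realType) (N : nat) (x : config N) : 'cV[R]_N :=
  \col_a (if x a then 1 else -1).

Definition ising_weight (R : realType) (N : nat) (J : 'M[R]_N)
    (x : config N) : R :=
  expR (2^-1 * ((spins R x)^T *m J *m spins R x) 0 0).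

Definition ising_partition_function (R : realType) (N : nat) (J : 'M[R]_N) : R :=
  \sum_(x : config N) ising_weight J x.

Definition ising_measure (R : realType) (N : nat) (J : 'M[R]_N)
    (E : {set config N}) : R :=
  \sum_(x in E) (ising_partition_function J)^-1 * ising_weight J x.

Lemma ising_measure_setT (R : realType) (N : nat) (J : 'M[R]_N) :
  ising_measure J [set: config N]%SET = 1.
Proof.
rewrite /ising_measure -big_distrr /= (eq_bigl xpredT) => [|x]; last by rewrite inE.
rewrite mulVf // gt_eqF // /ising_partition_function (bigD1 [ffun=> true]) //=.
by rewrite ltr_pwDl ?expR_gt0 // sumr_ge0 // => x _; exact: expR_ge0.
Qed.

Definition magnetization (R : realType) (k N : nat) (B : 'I_k -> {set 'I_N})
    (x : config N) : 'cV[R]_k :=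
  \col_i (#|B i|%:R^-1 * \sum_(a in B i) spins R x a 0).

(* Main.v *)
Require Import Defs.
From mathcomp Require Import all_boot all_order all_algebra.
From mathcomp Require Import all_classical all_reals all_analysis.
From mathcomp Require Import ring lra.
Import Order.TTheory GRing.Theory Num.Theory.
Import numFieldNormedType.Exports.

Set Implicit Arguments.
Unset Strict Implicit.
Unset Printing Implicit Defensive.

Local Open Scope classical_set_scope.
Local Open Scope ring_scope.

(** Write m for the vector of block magnetizations of a configuration and
    p i = |B i| / N for the block proportions.  The Gibbs weight depends on m
    only: it is exp (N/2 * sum_ij A i j (p i p j) (m i m j)).  Since A is
    positive definite all weights are at least 1, so the partition function is
    at least 2^N.  There are at most (N + 1)^k values of m, so everything
    reduces to an upper bound, for a single value m, of the number of
    configurations with this magnetization.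

    That bound is Chernoff's, with the spins of block i tilted by t = m i.  As
    cosh t <= exp (t^2/2 - t^4/200) on [-1, 1], the proportion of
    configurations with magnetization m is at most
    exp (- N sum_i p i (m i^2/2 + m i^4/200)).  The quadratic part of this
    entropy is just enough to absorb the energy: when p i is replaced by its
    limit gamma i^2, the energy is half the quadratic form of
    diag(gamma) A diag(gamma) at the vector (gamma i * m i), which the bound on
    the operator norm makes at most 1/2 sum_i gamma i^2 m i^2.  The quartic
    part survives, and this is why the critical case of norm exactly 1 is
    covered.

    The replacement of p by its limit costs an error that tends to 0 uniformly
    in m, because |m i| <= 1; and a norm of m of at least eps forces some
    |m i| to be at least a fixed eta.  Hence the exponent per site is
    eventually at most -2I for some I > 0, and half of it pays for the
    polynomial number (N + 1)^k of values of m.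

    The entropy bound is [card_config_profile_le], the comparison of energy
    and entropy is [level_exponent_le], and [ising_measure_le] performs the
    sum over the values of m. *)

(** * A quartic improvement of the Gaussian bound for cosh *)

Lemma ge0_of_is_derive (R : realType) (f df : R -> R) :
  (forall x : R, is_derive x 1 f (df x)) -> 0 <= f 0 ->
  (forall x, 0 <= x <= 1 -> 0 <= df x) ->
  forall x, 0 <= x <= 1 -> 0 <= f x.
Proof.
move=> fdf f0 df0 x /andP[x0 x1].
apply: (le_trans f0).
apply: (@ger0_derive1_ndecr R f 0 1) => // [y|].
- rewrite in_itv /= => /andP[y0 y1].
  by rewrite derive1E (@derive_val _ _ _ _ _ _ _ (fdf y)) df0 // !ltW.
- by apply: derivable_within_continuous => y _; have [] := fdf y.
Qed.

(** The bound e <= 3 comes from 1 / e = (exp (-1/6))^6 >= (5/6)^6 >= 1/3. *)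
Lemma expR_le3 (R : realType) (x : R) : x <= 1 -> expR x <= 3.
Proof.
move=> x1; apply: (@le_trans _ _ (expR 1)); first by rewrite ler_expR.
have e6 : 5 / 6 <= expR (- 6^-1 : R).
  by apply: le_trans (expR_ge1Dx _); lra.
have q3 : 3^-1 <= expR (- 1 : R).
  have -> : expR (-1) = expR (- 6^-1 : R) ^+ 6.
    by rewrite -expRM_natl; congr expR; field.
  apply: (@le_trans _ _ ((5 / 6) ^+ 6)); first by lra.
  by rewrite lerXn2r // nnegrE ?expR_ge0 //; lra.
rewrite -(ler_pM2r (expR_gt0 (-1))) expRxMexpNx_1.
lra.
Qed.

(** Four integrations from 0 of the inequality exp x + exp (- x) <= 4.  The
    fourth-order coefficient 1/6 is twice the one of the Taylor expansion, so
    that this crude inequality suffices. *)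
Lemma expRD_expRN_le (R : realType) (x : R) : 0 <= x <= 1 ->
  expR x + expR (- x) <= 2 + x ^+ 2 + x ^+ 4 / 6.
Proof.
pose f3 (x : R) := 4 * x - expR x + expR (- x).
pose f2 (x : R) := 2 + 2 * x ^+ 2 - expR x - expR (- x).
pose f1 (x : R) := 2 * x + 2 / 3 * x ^+ 3 - expR x + expR (- x).
pose f0 (x : R) := 2 + x ^+ 2 + x ^+ 4 / 6 - expR x - expR (- x).
have f3_ge0 : forall x, 0 <= x <= 1 -> 0 <= f3 x.
  apply: (@ge0_of_is_derive _ _ (fun x => 4 - expR x - expR (- x)))
    => [y||y /andP[y0 y1]].
  - by apply: is_derive_eq; rewrite /GRing.scale /=; ring.
  - by rewrite /f3 oppr0 expR0; lra.
  - have := @expR_le3 _ y y1; have : expR (- y) <= 1 by rewrite expR_le1; lra.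
    lra.
have f2_ge0 : forall x, 0 <= x <= 1 -> 0 <= f2 x.
  apply: (@ge0_of_is_derive _ _ f3) => [y||//].
  - by apply: is_derive_eq; rewrite /GRing.scale /= /f3; ring.
  - by rewrite /f2 oppr0 expR0; lra.
have f1_ge0 : forall x, 0 <= x <= 1 -> 0 <= f1 x.
  apply: (@ge0_of_is_derive _ _ f2) => [y||//].
  - by apply: is_derive_eq; rewrite /GRing.scale /= /f2; field.
  - by rewrite /f1 oppr0 expR0; lra.
move=> x01; rewrite -subr_ge0.
suff : 0 <= f0 x by rewrite /f0; lra.
apply: (@ge0_of_is_derive _ f0 f1) x01 => [y||//].
- by apply: is_derive_eq; rewrite /GRing.scale /= /f1; field.
- by rewrite /f0 oppr0 expR0; lra.
Qed.

Lemma expR_ge_quadratic (R : realType) (u : R) : 0 <= u ->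
  1 + u + 3 / 8 * u ^+ 2 <= expR u.
Proof.
move=> u0.
(* Compare exp u with (1 + u/4)^4; the exponent 4 is the smallest one for which
   the coefficient of u^2 is large enough for the quartic gain below. *)
have -> : expR u = expR (u / 4) ^+ 4 by rewrite -expRM_natl; congr expR; field.
apply: (@le_trans _ _ ((1 + u / 4) ^+ 4)); last first.
  by rewrite lerXn2r // ?nnegrE ?expR_ge0 ?expR_ge1Dx //; lra.
have -> : (1 + u / 4) ^+ 4 =
    1 + u + 3 / 8 * u ^+ 2 + (u ^+ 3 / 16 + u ^+ 4 / 256) by field.
have := exprn_ge0 3 u0; have := exprn_ge0 4 u0; lra.
Qed.

(** The strict gain over the Gaussian bound cosh t <= exp (t^2/2).  With
    u = t^2/2 - t^4/200, the square u^2 is at least (99/200)^2 t^4, so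
    1 + u + 3/8 u^2 has a coefficient of t^4 of at least
    3/8 (99/200)^2 - 1/200 > 1/12, which is the one of the upper bound for
    cosh t. *)
Lemma expRD_expRN_le_expR (R : realType) (t : R) : `|t| <= 1 ->
  expR t + expR (- t) <= 2 * expR (t ^+ 2 / 2 - t ^+ 4 / 200).
Proof.
move=> t1.
have -> : expR t + expR (- t) = expR `|t| + expR (- `|t|).
  by case: (ler0P t) => _; rewrite // opprK addrC.
have -> : t ^+ 4 = (t ^+ 2) ^+ 2 by rewrite -exprM.
rewrite -(real_normK (num_real t)).
have t0 := normr_ge0 t.
have t01 : 0 <= `|t| <= 1 by rewrite t0.
apply: (le_trans (expRD_expRN_le t01)).
have -> : `|t| ^+ 4 = (`|t| ^+ 2) ^+ 2 by rewrite -exprM.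
have : `|t| ^+ 2 <= 1 by rewrite expr_le1.
have : 0 <= `|t| ^+ 2 by exact: sqr_ge0.
move: (`|t| ^+ 2) => y y0 y1 {t t1 t0 t01}.
set u := y / 2 - y ^+ 2 / 200.
have u_ge : 99 / 200 * y <= u by rewrite /u; nra.
have u0 : 0 <= u by lra.
have := expR_ge_quadratic u0.
have : (99 / 200 * y) ^+ 2 <= u ^+ 2 by rewrite lerXn2r // nnegrE; lra.
have : 0 <= y ^+ 2 by exact: sqr_ge0.
rewrite exprMn; set v := u ^+ 2; rewrite /u; lra.
Qed.

(** * Counting configurations *)

(** Up to the factor 2^N, this is the moment generating function of N
    independent symmetric spins. *)
Lemma sum_config_expR (R : realType) (N : nat) (v : 'I_N -> R) :
  \sum_(x : config N) expR (\sum_a v a * spins R x a 0) =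
  \prod_a (expR (v a) + expR (- v a)).
Proof.
transitivity (\prod_(a < N) \sum_(b : bool) expR (v a * (if b then 1 else -1))).
  rewrite bigA_distr_bigA; apply: eq_bigr => x _; rewrite expR_sum.
  apply: eq_bigr => a _.
  by rewrite mxE.
by apply: eq_bigr => a _; rewrite big_bool mulr1 mulrN1.
Qed.

(** Chernoff bound for the number of configurations whose spins have prescribed
    linear statistics: Markov's inequality for the exponential tilt by v, which
    is the tilt that is optimal to second order when v is the prescribed
    profile of local averages.  The condition on P expresses exactly this: the
    inner product of v with the spins is the squared norm of v. *)
Lemma card_config_profile_le (R : realType) (N : nat) (v : 'I_N -> R)
    (P : pred (config N)) :
  (forall a, `|v a| <= 1) ->
  (forall x, P x -> \sum_a v a * spins R x a 0 = \sum_a v a ^+ 2) ->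
  \sum_(x | P x) 1 <=
    2 ^+ N * expR (- \sum_a (v a ^+ 2 / 2 + v a ^+ 4 / 200)).
Proof.
move=> v1 vP.
have expSE (x : R) : 0 < expR x by exact: expR_gt0.
rewrite -(ler_pM2r (expSE (\sum_a v a ^+ 2))) big_distrl /= -mulrA -expRD.
apply: (@le_trans _ _ (\sum_(x : config N) expR (\sum_a v a * spins R x a 0))).
  rewrite [leRHS](bigID P) /= ler_wpDr //.
    by apply: sumr_ge0 => x _; exact: expR_ge0.
  by apply: ler_sum => x Px; rewrite mul1r (vP x).
rewrite sum_config_expR -sumrN -big_split /= expR_sum.
rewrite -[N in 2 ^+ N]card_ord -prodr_const -big_split /=.
apply: ler_prod => a _; rewrite addr_ge0 ?expR_ge0 //=.
apply: (le_trans (expRD_expRN_le_expR (v1 a))).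
rewrite (_ : - _ + _ = v a ^+ 2 / 2 - v a ^+ 4 / 200) //; lra.
Qed.

(** * The quadratic form and the operator norm *)

Lemma sum_sqr_mulmx_le (R : realType) (k : nat) (M : 'M[R]_k)
    (w : 'cV[R]_k) :
  opnorm2 M <= 1 -> \sum_i (M *m w) i 0 ^+ 2 <= \sum_i w i 0 ^+ 2.
Proof.
move=> M1.
have sq_ge0 (u : 'cV[R]_k) : 0 <= \sum_i u i 0 ^+ 2.
  by apply: sumr_ge0 => i _; exact: sqr_ge0.
have sumZ (a : R) (u : 'cV[R]_k) :
    \sum_i (a *: u) i 0 ^+ 2 = a ^+ 2 * \sum_i u i 0 ^+ 2.
  by rewrite big_distrr; apply: eq_bigr => i _; rewrite mxE exprMn.
have [w0|w0] := eqVneq (\sum_i w i 0 ^+ 2) 0.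
  suff -> : w = 0.
    by rewrite mulmx0 !big1 // => i _; rewrite mxE expr0n.
  apply/colP => i; rewrite mxE; apply/eqP; rewrite -sqrf_eq0; apply/eqP.
  by move/psumr_eq0P: w0; apply=> // j _; exact: sqr_ge0.
set s := \sum_i w i 0 ^+ 2 in w0 *.
have s_gt0 : 0 < s by rewrite lt_def w0 sq_ge0.
pose a := (Num.sqrt s)^-1.
have a2 : a ^+ 2 = s^-1 by rewrite exprVn sqr_sqrtr // ltW.
have le1 : euclidean_norm (M *m (a *: w)) <= 1.
  apply: le_trans M1; apply: sup_upper_bound; first exact: has_sup_opnorm2.
  exists (a *: w) => //=.
  by rewrite /euclidean_norm sumZ a2 mulVf // sqrtr1.
move: le1; rewrite /euclidean_norm -scalemxAr sumZ -[leRHS]sqrtr1.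
rewrite ler_psqrt ?nnegrE ?ler01 ?(mulr_ge0 (sqr_ge0 _) (sq_ge0 _)) //.
by rewrite a2 mulrC ler_pdivrMr // mul1r.
Qed.

Lemma mul_tr_mulmxE (R : realType) (k : nat) (M : 'M[R]_k) (w : 'cV[R]_k) :
  (w^T *m M *m w) 0 0 = \sum_i \sum_j w i 0 * M i j * w j 0.
Proof.
rewrite -mulmxA mxE; apply: eq_bigr => i _; rewrite !mxE big_distrr.
by apply: eq_bigr => j _; rewrite /= mulrA.
Qed.

(** The inequality 2ab <= a^2 + b^2, summed over the coordinates of w and M w,
    replaces Cauchy-Schwarz here since the norm of M is at most 1. *)
Lemma quadratic_form_le_opnorm2 (R : realType) (k : nat) (M : 'M[R]_k)
    (w : 'cV[R]_k) :
  opnorm2 M <= 1 -> (w^T *m M *m w) 0 0 <= \sum_i w i 0 ^+ 2.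
Proof.
move=> M1; have := sum_sqr_mulmx_le w M1.
rewrite -mulmxA mxE; set u := M *m w => uw.
have : \sum_i 2 * (w^T 0 i * u i 0) <= \sum_i (w i 0 ^+ 2 + u i 0 ^+ 2).
  apply: ler_sum => i _; rewrite mxE; move: (w i 0) (u i 0) => b c.
  by have := sqr_ge0 (b - c); rewrite sqrrB; lra.
by rewrite -big_distrr big_split /=; lra.
Qed.

Lemma quadratic_form_diag_le (R : realType) (k : nat) (A : 'M[R]_k)
    (g : 'rV[R]_k) (m : 'I_k -> R) :
  opnorm2 (diag_mx g *m A *m diag_mx g) <= 1 ->
  \sum_i \sum_j A i j * (g 0 i ^+ 2 * g 0 j ^+ 2) * (m i * m j) <=
  \sum_i g 0 i ^+ 2 * m i ^+ 2.
Proof.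
move=> /(quadratic_form_le_opnorm2 (\col_i (g 0 i * m i))).
rewrite mul_tr_mulmxE => le.
rewrite [leLHS](_ : _ = \sum_i \sum_j (\col_i (g 0 i * m i)) i 0 *
    (diag_mx g *m A *m diag_mx g) i j * (\col_i (g 0 i * m i)) j 0).
  by apply: (le_trans le); apply: ler_sum => i _; rewrite mxE exprMn.
apply: eq_bigr => i _; apply: eq_bigr => j _.
by rewrite mul_mx_diag mxE mul_diag_mx !mxE; ring.
Qed.

(** * The Ising measure in terms of magnetizations *)

(** The limit of this proportion in large systems is gamma i ^ 2. *)
Definition block_proportion (R : realType) (k N : nat) (B : 'I_k -> {set 'I_N})
  (i : 'I_k) : R := #|B i|%:R / N%:R.

Definition interaction_energy (R : realType) (k : nat) (A : 'M[R]_k)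
    (p m : 'I_k -> R) : R :=
  \sum_i \sum_j A i j * (p i * p j) * (m i * m j).

(** Per site, the energy at magnetization m minus the entropic cost of m: on
    [-1, 1] the quartic polynomial is a lower bound of the rate function
    sup_t (t m - ln (cosh t)) of a symmetric spin. *)
Definition level_exponent (R : realType) (k : nat) (A : 'M[R]_k)
    (p m : 'I_k -> R) : R :=
  2^-1 * interaction_energy A p m -
  \sum_i p i * (m i ^+ 2 / 2 + m i ^+ 4 / 200).

Lemma interaction_energy_ge0 (R : realType) (k : nat) (A : 'M[R]_k)
    (p m : 'I_k -> R) :
  positive_definite A -> 0 <= interaction_energy A p m.
Proof.
move=> pd; pose w : 'cV[R]_k := \col_i (p i * m i).
have -> : interaction_energy A p m = (w^T *m A *m w) 0 0.
  rewrite mul_tr_mulmxE; apply: eq_bigr => i _; apply: eq_bigr => j _.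
  by rewrite !mxE; ring.
have [->|w0] := eqVneq w 0; first by rewrite mulmx0 mxE.
exact/ltW/pd.
Qed.

(** A site of two different blocks would be smaller than itself by the ordering
    of the blocks, so the blocks are disjoint. *)
Lemma mem_block (k N : nat) (B : 'I_k -> {set 'I_N}) (h : 'I_N -> 'I_k) :
  ordered_block_partition B -> (forall a, a \in B (h a)) ->
  forall a i, (a \in B i) = (h a == i).
Proof.
case=> _ _ ord hB a i; apply/idP/eqP => [aBi|<- //].
apply/val_inj; case: (ltngtP (h a) i) => // lt.
- by have := ord _ _ _ _ (hB a) aBi lt; rewrite ltnn.
- by have := ord _ _ _ _ aBi (hB a) lt; rewrite ltnn.
Qed.

Lemma card_block_proportion (R : realType) (k N : nat) (B : 'I_k -> {set 'I_N})
    i :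
  #|B i|%:R = N%:R * block_proportion R B i.
Proof.
rewrite /block_proportion; case: N B => [|N] B; last first.
  by rewrite mulrC divfK // pnatr_eq0.
by rewrite mul0r; apply/eqP; rewrite pnatr_eq0 cards_eq0; apply/eqP/setP => -[].
Qed.

Lemma sum_spins_block (R : realType) (k N : nat) (B : 'I_k -> {set 'I_N})
    (x : config N) i :
  \sum_(a in B i) spins R x a 0 = #|B i|%:R * magnetization R B x i 0.
Proof.
rewrite mxE; have [B0|Bn0] := eqVneq #|B i| 0%N.
  by rewrite B0 mul0r big_pred0 // => a; rewrite (cards0_eq B0) inE.
by rewrite mulVKf // pnatr_eq0.
Qed.

Lemma magnetization_le1 (R : realType) (k N : nat) (B : 'I_k -> {set 'I_N})
    (x : config N) i : `|magnetization R B x i 0| <= 1.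
Proof.
rewrite mxE normrM; have [B0|Bn0] := eqVneq #|B i| 0%N.
  by rewrite B0 invr0 normr0 mul0r.
rewrite ger0_norm ?invr_ge0 // mulrC ler_pdivrMr ?ltr0n ?lt0n // mul1r.
apply: (le_trans (ler_norm_sum _ _ _)).
rewrite -sum1_card natr_sum; apply: ler_sum => a _.
by rewrite mxE; case: ifP; rewrite ?normrN normr1.
Qed.

Lemma sum_spins_count (R : realType) (k N : nat) (B : 'I_k -> {set 'I_N})
    (x : config N) i :
  \sum_(a in B i) spins R x a 0 =
  2 * #|[set a in B i | x a]%SET|%:R - #|B i|%:R.
Proof.
have -> : #|[set a in B i | x a]%SET| = (\sum_(a in B i) x a)%N.
  rewrite -sum1_card big_mkcond /= [RHS]big_mkcond /=.
  by apply: eq_bigr => a _; rewrite !inE; case: (a \in B i); case: (x a).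
rewrite -sum1_card !natr_sum big_distrr -sumrB /=; apply: eq_bigr => a _.
by rewrite mxE; case: (x a) => /=; ring.
Qed.

Section Blocks.
Context (R : realType) (k N : nat) (B : 'I_k -> {set 'I_N}) (h : 'I_N -> 'I_k).
Context (hB : forall a i, (a \in B i) = (h a == i)).

Lemma sum_over_blocks (F : 'I_k -> R) (G : 'I_N -> R) :
  \sum_a F (h a) * G a = \sum_i F i * \sum_(a in B i) G a.
Proof.
rewrite (partition_big h xpredT) //=; apply: eq_bigr => i _.
by rewrite big_distrr; apply: eq_big => [a|a /eqP <-] //; rewrite hB.
Qed.

Lemma sum_fun_block (F : 'I_k -> R) :
  \sum_a F (h a) = N%:R * \sum_i block_proportion R B i * F i.
Proof.
have -> : \sum_a F (h a) = \sum_a F (h a) * 1.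
  by apply: eq_bigr => a _; rewrite mulr1.
rewrite sum_over_blocks big_distrr; apply: eq_bigr => i _ /=.
by rewrite sumr_const card_block_proportion; ring.
Qed.

Lemma spins_energyE (A : 'M[R]_k) (x : config N) :
  ((spins R x)^T *m block_interaction A h *m spins R x) 0 0 =
  N%:R * interaction_energy A (block_proportion R B)
           (fun i => magnetization R B x i 0).
Proof.
pose S i := \sum_(a in B i) spins R x a 0.
rewrite mul_tr_mulmxE.
transitivity (\sum_a (\sum_j N%:R^-1 * A (h a) j * S j) * spins R x a 0).
  apply: eq_bigr => a _; rewrite -sum_over_blocks big_distrl /=.
  by apply: eq_bigr => b _; rewrite [block_interaction _ _ _ _]mxE; ring.
rewrite (sum_over_blocks (fun i => \sum_j N%:R^-1 * A i j * S j)).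
rewrite /interaction_energy big_distrr; apply: eq_bigr => i _ /=.
rewrite big_distrl big_distrr; apply: eq_bigr => j _ /=.
rewrite /S !sum_spins_block !card_block_proportion.
have [->|N0] := eqVneq (N%:R : R) 0; first by rewrite invr0; ring.
by field.
Qed.

Lemma ising_weightE (A : 'M[R]_k) (x : config N) :
  ising_weight (block_interaction A h) x =
  expR (N%:R * (2^-1 * interaction_energy A (block_proportion R B)
                         (fun i => magnetization R B x i 0))).
Proof. by rewrite /ising_weight spins_energyE; congr expR; ring. Qed.

(** The energy of every configuration is nonnegative, so every weight is at
    least 1. *)
Lemma partition_function_ge (A : 'M[R]_k) : positive_definite A ->
  2 ^+ N <= ising_partition_function (block_interaction A h).
Proof.
move=> pd; apply: (@le_trans _ _ (\sum_(x : config N) 1)).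
  by rewrite sumr_const card_ffun card_bool card_ord natrX.
apply: ler_sum => x _; rewrite ising_weightE -expR0 ler_expR.
by rewrite !mulr_ge0 // interaction_energy_ge0.
Qed.

(** The weight is constant on the level set, whose cardinality is bounded by
    tilting each site by the magnetization of its block. *)
Lemma level_set_weight_le (A : 'M[R]_k) (x0 : config N) :
  \sum_(x : config N | magnetization R B x == magnetization R B x0)
     ising_weight (block_interaction A h) x <=
  2 ^+ N * expR (N%:R * level_exponent A (block_proportion R B)
                          (fun i => magnetization R B x0 i 0)).
Proof.
set m := fun i : 'I_k => magnetization R B x0 i 0.
rewrite (eq_bigr (fun=> expR (N%:R * (2^-1 *
    interaction_energy A (block_proportion R B) m)) * 1)); last first.
  by move=> x /eqP xx0; rewrite ising_weightE xx0 mulr1.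
rewrite -big_distrr /= /level_exponent mulrBr expRD [leRHS]mulrCA.
rewrite ler_pM2l ?expR_gt0 //.
rewrite -(sum_fun_block (fun i => m i ^+ 2 / 2 + m i ^+ 4 / 200)).
apply: (@card_config_profile_le _ _ (fun a => m (h a))).
  by move=> a; exact: magnetization_le1.
move=> x /eqP xx0; rewrite sum_over_blocks (sum_fun_block (fun i => m i ^+ 2)).
rewrite big_distrr; apply: eq_bigr => i _ /=.
by rewrite sum_spins_block card_block_proportion xx0 -/(m i); ring.
Qed.

(** The magnetization is determined by the numbers of positive spins in the k
    blocks, for which there are at most (N + 1)^k possibilities; each of the
    corresponding level sets that meets E contributes at most exp (N c) after
    division by the partition function. *)
Lemma ising_measure_le (A : 'M[R]_k) (E : {set config N}) (c : R) :
  positive_definite A ->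
  (forall x, x \in E -> level_exponent A (block_proportion R B)
                          (fun i => magnetization R B x i 0) <= c) ->
  ising_measure (block_interaction A h) E <=
  N.+1%:R ^+ k * expR (N%:R * c).
Proof.
move=> pd Ec; set J := block_interaction A h.
have Z_ge := partition_function_ge pd.
have pow_gt0 : 0 < 2 ^+ N :> R by rewrite exprn_gt0.
have w_ge0 x : 0 <= ising_weight J x by exact: expR_ge0.
rewrite /ising_measure -big_distrr /= mulrC ler_pdivrMr;
  last exact: lt_le_trans Z_ge.
apply: (@le_trans _ _ (N.+1%:R ^+ k * expR (N%:R * c) * 2 ^+ N)); last first.
  by apply: ler_wpM2l Z_ge; rewrite mulr_ge0 ?exprn_ge0 ?expR_ge0.
pose count (x : config N) : {ffun 'I_k -> 'I_N.+1} :=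
  [ffun i => inord #|[set a in B i | x a]%SET|].
have count_lt (x : config N) i : (#|[set a in B i | x a]%SET| < N.+1)%N.
  by rewrite ltnS -[leqRHS]card_ord max_card.
have countP x y : count x = count y ->
    magnetization R B x = magnetization R B y.
  move=> /ffunP xy; apply/colP => i; rewrite !mxE !sum_spins_count.
  by have := xy i; rewrite !ffunE => /(congr1 val); rewrite /= !inordK // => ->.
rewrite (partition_big count xpredT) //=.
apply: (@le_trans _ _
    (\sum_(f : {ffun 'I_k -> 'I_N.+1}) expR (N%:R * c) * 2 ^+ N));
  last by rewrite sumr_const card_ffun !card_ord -[leLHS]mulr_natl natrX mulrA.
apply: ler_sum => f _.
have [x0 /andP[x0E /eqP x0f]|none] :=
    pickP (fun x => (x \in E) && (count x == f)); last first.
  by rewrite big_pred0 // mulr_ge0 ?expR_ge0 // ltW.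
apply: (@le_trans _ _ (\sum_(x : config N |
    magnetization R B x == magnetization R B x0) ising_weight J x)).
  rewrite big_mkcond [leRHS]big_mkcond; apply: ler_sum => x _.
  case: ifP => [/andP[_ /eqP xf]|_]; last by case: ifP.
  by rewrite (countP x x0) ?eqxx // xf.
apply: (le_trans (level_set_weight_le A x0)).
by rewrite mulrC ler_pM2r // ler_expR ler_wpM2l // Ec.
Qed.

End Blocks.

(** * The limit of large systems *)

(** The quadratic part of the entropy cancels the limiting energy, by the bound
    on the operator norm; what remains of the exponent is the quartic term and
    an error due to the difference between p and its limit, which does not
    depend on m. *)
Lemma level_exponent_le (R : realType) (k : nat) (A : 'M[R]_k)
    (g : 'rV[R]_k) (p m : 'I_k -> R) :
  opnorm2 (diag_mx g *m A *m diag_mx g) <= 1 -> (forall i, `|m i| <= 1) ->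
  level_exponent A p m <=
  \sum_i \sum_j `|A i j| * `|p i * p j - g 0 i ^+ 2 * g 0 j ^+ 2| +
  \sum_i `|p i - g 0 i ^+ 2| - \sum_i g 0 i ^+ 2 * m i ^+ 4 / 200.
Proof.
move=> op m1; have := quadratic_form_diag_le m op.
set Q := (X in X <= _) => Qle.
set D := \sum_i \sum_j `|A i j| * _.
have energy_le : interaction_energy A p m <= Q + D.
  rewrite /interaction_energy -big_split; apply: ler_sum => i _ /=.
  rewrite -big_split; apply: ler_sum => j _ /=.
  rewrite -lerBlDl -mulrBl -mulrBr.
  apply: (le_trans (ler_norm _)); rewrite !normrM ler_piMr ?mulr_ge0 //.
  by rewrite mulr_ile1.
have D0 : 0 <= D by do 2!apply: sumr_ge0 => ? _; rewrite mulr_ge0.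
have : - \sum_i p i * (m i ^+ 2 / 2 + m i ^+ 4 / 200) <=
    \sum_i `|p i - g 0 i ^+ 2| - \sum_i g 0 i ^+ 2 * m i ^+ 4 / 200 -
    2^-1 * \sum_i g 0 i ^+ 2 * m i ^+ 2.
  rewrite big_distrr -!sumrB -sumrN; apply: ler_sum => i _ /=.
  have y0 : 0 <= m i ^+ 2 by exact: sqr_ge0.
  have y1 : m i ^+ 2 <= 1 by rewrite -real_normK ?num_real // expr_le1.
  have -> : m i ^+ 4 = (m i ^+ 2) ^+ 2 by rewrite -exprM.
  move: (m i ^+ 2) (g 0 i ^+ 2) y0 y1 => y s y0 y1.
  have z0 : 0 <= y ^+ 2 by exact: sqr_ge0.
  have z1 : y ^+ 2 <= 1 by rewrite expr_le1.
  set f := y / 2 + y ^+ 2 / 200.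
  have f0 : 0 <= f by rewrite /f; lra.
  have f1 : f <= 1 by rewrite /f; lra.
  have : (s - p i) * f <= `|p i - s|.
    apply: (le_trans (ler_norm _)); rewrite normrM distrC ler_piMr //.
    by rewrite ger0_norm.
  by rewrite /f; lra.
rewrite /level_exponent; lra.
Qed.

(** The easy half of the equivalence of norms: nrm is at most a constant times
    the maximum of the absolute values of the coordinates.  The 1 in C below
    makes C positive also when k = 0. *)
Lemma coordinate_ge_of_norm_ge (R : realType) (k : nat) (nrm : 'cV[R]_k -> R) :
  is_norm nrm -> forall eps, 0 < eps -> exists2 eta, 0 < eta &
    forall m, eps <= nrm m -> exists i, eta <= `|m i 0|.
Proof.
case=> nrmD nrmZ _ eps eps0.
have nrm0 : nrm 0 = 0 by rewrite -(scale0r 0) nrmZ normr0 mul0r.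
have nrm_ge0 v : 0 <= nrm v.
  have := nrmD v (-1 *: v); rewrite nrmZ normrN1 mul1r scaleN1r subrr nrm0; lra.
have nrm_sum (F : 'I_k -> 'cV[R]_k) : nrm (\sum_i F i) <= \sum_i nrm (F i).
  elim/big_rec2 : _ => [|i y x _ le]; first by rewrite nrm0.
  by apply: (le_trans (nrmD _ _)); rewrite lerD2l.
pose C := 1 + \sum_i nrm (delta_mx i 0).
have C0 : 0 < C by rewrite /C ltr_pwDl // sumr_ge0.
exists (eps / C); first exact: divr_gt0.
move=> m le_m; apply/existsP; apply: contraLR le_m.
rewrite negb_exists => /forallP small; rewrite -ltNge.
have mE : m = \sum_i m i 0 *: delta_mx i 0.
  by rewrite {1}[m]matrix_sum_delta; apply: eq_bigr => i _; rewrite big_ord1.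
rewrite mE; apply: (le_lt_trans (nrm_sum _)).
apply: (@le_lt_trans _ _ (\sum_i eps / C * nrm (delta_mx i 0))).
  apply: ler_sum => i _; rewrite nrmZ ler_wpM2r //.
  by have := small i; rewrite -ltNge => /ltW.
rewrite -big_distrr /= mulrAC ltr_pdivrMr // ltr_pM2l // /C; lra.
Qed.

(** With t = c / (k + 1), exp (N t) >= 1 + (N t)^2 / 2 >= 1 + N once
    N t^2 >= 2; then take the k-th power.  Dividing by k + 1 rather than k
    avoids a division by 0. *)
Lemma pow_le_expR (R : realType) (k N : nat) (c : R) : 0 < c ->
  2 * (k.+1%:R / c) ^+ 2 <= N%:R -> N.+1%:R ^+ k <= expR (N%:R * c).
Proof.
move=> c0 Nbig; pose t := c / k.+1%:R.
have t0 : 0 < t by rewrite divr_gt0 // ltr0Sn.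
have t2N : 2 <= t ^+ 2 * N%:R.
  move: Nbig; rewrite -[k.+1%:R / c]invf_div exprVn mulrC.
  by rewrite ler_pdivrMl ?exprn_gt0 // -/t => /le_trans; apply; rewrite mulrC.
have base : N.+1%:R <= expR (N%:R * t).
  have Nt0 : 0 <= N%:R * t by rewrite mulr_ge0 // ltW.
  have := expR_ge1Dxn 1 Nt0; apply: le_trans.
  rewrite -natr1 addrC lerD2l exprMn (_ : 2`!%:R = 2) //.
  have : 0 <= N%:R :> R by []. nra.
apply: (@le_trans _ _ (expR (N%:R * t) ^+ k)).
  by rewrite lerXn2r // nnegrE ?expR_ge0.
rewrite -expRM_natl ler_expR mulrCA ler_wpM2l // /t mulrCA ler_piMr //;
  first exact: ltW.
by rewrite ler_pdivrMr ?ltr0Sn // mul1r ler_nat.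
Qed.

Lemma ge_id_of_increasing (N : nat -> nat) :
  {homo N : m n / (m < n)%N} -> forall n, (n <= N n)%N.
Proof.
by move=> incr; elim=> // n IHn; apply: (leq_ltn_trans IHn); exact: incr.
Qed.

Lemma cvg_sum_ord (R : realType) (k : nat) (u : nat -> 'I_k -> R)
    (l : 'I_k -> R) :
  (forall i, u n i @[n --> \oo] --> l i) ->
  \sum_i u n i @[n --> \oo] --> \sum_i l i.
Proof.
move=> ul; apply: (@cvg_big _ _ +%R 0) => [|i _]; last exact: ul.
exact: add_continuous.
Qed.

Theorem corollary1p2 (R : realType) (k : nat)
  (A : 'M[R]_k) (A_sym : A^T = A) (A_pd : positive_definite A)
  (N : nat -> nat) (N_incr : {homo N : m n / (m < n)%N})
  (B : forall n : nat, 'I_k -> {set 'I_(N n)})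
  (B_part : forall n : nat, ordered_block_partition (B n))
  (gamma : 'rV[R]_k)
  (gamma_lim : forall i : 'I_k,
     Num.sqrt (#|B n i|%:R / (N n)%:R : R) @[n --> \oo] --> gamma 0 i)
  (gamma01 : forall i : 'I_k, 0 < gamma 0 i < 1)
  (h : forall n : nat, 'I_(N n) -> 'I_k)
  (h_block : forall (n : nat) (a : 'I_(N n)), a \in B n (h n a))
  (nrm : 'cV[R]_k -> R) (nrm_norm : is_norm nrm)
  (A_le1 : opnorm2 (diag_mx gamma *m A *m diag_mx gamma) <= 1) :
  forall eps : R, 0 < eps ->
    exists2 I : R, 0 < I &
      \forall n \near \oo,
        ising_measure (block_interaction A (h n))
          [set x : config (N n) | eps <= nrm (magnetization R (B n) x)]%SET
        <= expR (- ((N n)%:R * I)).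
Proof.
move=> eps eps0.
have [eta eta0 nrm_eta] := coordinate_ge_of_norm_ge nrm_norm eps0.
pose s i : R := gamma 0 i ^+ 2.
pose kappa : R := \big[Order.min/1]_i s i.
have kappa0 : 0 < kappa.
  rewrite /kappa; elim/big_ind : _ => // [x y x0 y0|i _].
    by rewrite lt_min x0 y0.
  by have /andP[g0 _] := gamma01 i; rewrite exprn_gt0.
(* Some term gamma i^2 m i^4 / 200 is at least 3I: one I absorbs the error
   [delta], one pays for the number of level sets and one remains. *)
pose I := kappa * eta ^+ 4 / 600.
have I0 : 0 < I by rewrite divr_gt0 // mulr_gt0 // exprn_gt0.
exists I => //.
pose p n i := block_proportion R (B n) i.
pose delta n : R := \sum_i \sum_j `|A i j| * `|p n i * p n j - s i * s j| +
  \sum_i `|p n i - s i|.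
have p_lim i : p n i @[n --> \oo] --> s i.
  have -> : (fun n => p n i) =
      (fun n => Num.sqrt (#|B n i|%:R / (N n)%:R) ^+ 2).
    by apply/funext => n; rewrite sqr_sqrtr // divr_ge0.
  by rewrite /s expr2; under eq_fun do rewrite expr2; exact: cvgM.
have delta_lim : delta n @[n --> \oo] --> (0 : R).
  have -> : 0 = \sum_i \sum_j `|A i j| * `|s i * s j - s i * s j| +
      \sum_i `|s i - s i|.
    rewrite big1 => [|i _]; last first.
      by rewrite big1 // => j _; rewrite subrr normr0 mulr0.
    by rewrite big1 ?addr0 // => i _; rewrite subrr normr0.
  apply: cvgD.
    apply: (cvg_sum_ord (u := fun n i =>
      \sum_j `|A i j| * `|p n i * p n j - s i * s j|)) => i.
    apply: (cvg_sum_ord (u := fun n j =>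
      `|A i j| * `|p n i * p n j - s i * s j|)) => j.
    apply: cvgMl_tmp; apply: cvg_norm; apply: cvgB; last exact: cvg_cst.
    exact: cvgM.
  apply: (cvg_sum_ord (u := fun n i => `|p n i - s i|)) => i.
  by apply: cvg_norm; apply: cvgB => //; exact: cvg_cst.
near=> n.
have hB := mem_block (B_part n) (h_block n).
have deltaI : delta n <= I.
  by near: n; exact: (cvgr_le 0 delta_lim).
have N_large : 2 * (k.+1%:R / I) ^+ 2 <= (N n)%:R.
  apply: (@le_trans _ _ n%:R); last by rewrite ler_nat ge_id_of_increasing.
  by near: n; exact: nbhs_infty_ger.
apply: (le_trans (ising_measure_le (c := - (2 * I)) hB A_pd _)) => [x|].
  rewrite inE => /nrm_eta[i eta_i].
  have m1 j := magnetization_le1 R (B n) x j.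
  apply: (le_trans (level_exponent_le _ A_le1 m1)).
  suff : 3 * I <= \sum_i s i * magnetization R (B n) x i 0 ^+ 4 / 200.
    by move: deltaI; rewrite /delta /p /s; lra.
  have -> : 3 * I = kappa * eta ^+ 4 / 200 by rewrite /I; field.
  rewrite (bigD1 i) //= ler_wpDr //.
    apply: sumr_ge0 => j _; rewrite divr_ge0 // mulr_ge0 ?sqr_ge0 //.
    by rewrite (_ : 4%N = 2 * 2)%N // exprM sqr_ge0.
  have kappa_le : kappa <= s i by exact: bigmin_le.
  rewrite ler_wpM2r // ler_pM ?exprn_ge0 ?(ltW kappa0) ?(ltW eta0) //.
  have -> : magnetization R (B n) x i 0 ^+ 4 =
      `|magnetization R (B n) x i 0| ^+ 4.
    by rewrite -normrX ger0_norm // (_ : 4%N = 2 * 2)%N // exprM sqr_ge0.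
  by rewrite lerXn2r // nnegrE ltW.
apply: (le_trans (ler_wpM2r (expR_ge0 _) (pow_le_expR I0 N_large))).
by rewrite -expRD ler_expR; lra.
Unshelve. all: by end_near.
Qed.
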